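(* Let $R$ be a maximal subring of a ring $T$ and let $R$ be a left Artinian ring. Assume that $(R:T)_l$ is not an ideal of $T$ and $(R:T)_lT$ is a proper ideal of $T$. Then the following hold: (1) $(R:T)_lT\in Max(T)$. (2) $R$ contains no maximal ideal of $T$; the contractions to $R$ of distinct maximal ideals of $T$ are distinct maximal ideals of $R$; in particular $|Max(T)|\leq |Max(R)|$. (3) If $I:=l.ann_T((R:T)_l)$, then either $(R:T)_lT$ is a minimal prime ideal of $T$ and $J(R)=J(T)\cap R$, or $I^2=0$, $I\subseteq Nil_*(T)$ and $(R:T)_lT=r.ann_T(I)$, whenever $I\neq 0$. (4) Either $J(R)=J(T)\cap R$ or $(R:T)_l$ is not a finitely generated right ideal of $R$. (5) Either $T(R:T)_r\in Max(T)$ or there exists a natural number $n$ such that $T$ embeds in $((R:T)_r)^n$ as a right $T$-module and therefore in $R^n$ as a right $R$-module.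
   Context: All rings are associative and unital (not necessarily commutative), and subrings contain the identity of the big ring; ''ideal'' means two-sided ideal. A maximal subring $R$ of $T$ is a proper subring with no subring strictly between $R$ and $T$. Conductors: $(R:T)_l=\{x\in T: Tx\subseteq R\}$ and $(R:T)_r=\{x\in T: xT\subseteq R\}$ (the largest left, resp. right, ideal of $T$ contained in $R$; both are ideals of $R$). $l.ann_T(X)=\{t\in T: tX=0\}$, $r.ann_T(X)=\{t\in T: Xt=0\}$. $Max$ denotes the set of maximal (two-sided) ideals, $J$ the Jacobson radical, $Nil_*$ the lower nilradical (intersection of all prime ideals). *)

(* Defs.v *)
From mathcomp Require Import all_boot all_algebra.
From mathcomp Require Import boolp classical_sets functions cardinality.

Set Implicit Arguments.
Unset Strict Implicit.
Unset Printing Implicit Defensive.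

Import GRing.Theory.
Local Open Scope classical_set_scope.
Local Open Scope ring_scope.

(* All ring-theoretic notions are stated for a subring S of an ambient ring T,
   both S and its ideals being sets of elements of T.  The notions for the
   ring T itself are obtained with S := setT. *)

Definition is_subring (T : pzRingType) (S : set T) : Prop :=
  GRing.subring_closed [in S].

Definition maximal_subring (T : pzRingType) (R : set T) : Prop :=
  [/\ is_subring R, R <> setT &
      forall S : set T, is_subring S -> R `<=` S -> S = R \/ S = setT].

Definition is_left_ideal (T : pzRingType) (S I : set T) : Prop :=
  [/\ I `<=` S, GRing.zmod_closed [in I] &
      forall s x, S s -> I x -> I (s * x)].

Definition is_right_ideal (T : pzRingType) (S I : set T) : Prop :=
  [/\ I `<=` S, GRing.zmod_closed [in I] &
      forall s x, S s -> I x -> I (x * s)].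

Definition is_ideal (T : pzRingType) (S I : set T) : Prop :=
  is_left_ideal S I /\ is_right_ideal S I.

Definition is_proper_ideal (T : pzRingType) (S I : set T) : Prop :=
  is_ideal S I /\ I <> S.

(* Finite sums of products a * b with a in A and b in B; this is the product
   of one-sided ideals, and also A T for B := setT and T A for A := setT. *)
Definition mulS (T : pzRingType) (A B : set T) : set T :=
  [set x | exists n (a b : 'I_n -> T),
     [/\ forall i, A (a i), forall i, B (b i) & x = \sum_(i < n) a i * b i]].

Definition left_artinian (T : pzRingType) (S : set T) : Prop :=
  forall L : nat -> set T,
    (forall n, is_left_ideal S (L n)) -> (forall n, L n.+1 `<=` L n) ->
    exists N, forall n, (N <= n)%N -> L n = L N.

Definition Max (T : pzRingType) (S : set T) : set (set T) :=
  [set M | is_proper_ideal S M /\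
           forall I, is_proper_ideal S I -> M `<=` I -> I = M].

Definition maximal_left_ideal (T : pzRingType) (S M : set T) : Prop :=
  [/\ is_left_ideal S M, M <> S &
      forall L, is_left_ideal S L -> L <> S -> M `<=` L -> L = M].

Definition jacobson (T : pzRingType) (S : set T) : set T :=
  [set x | S x /\ forall M, maximal_left_ideal S M -> M x].

Definition prime_ideal (T : pzRingType) (S P : set T) : Prop :=
  is_proper_ideal S P /\
  forall A B, is_ideal S A -> is_ideal S B -> mulS A B `<=` P ->
    A `<=` P \/ B `<=` P.

Definition minimal_prime_ideal (T : pzRingType) (S P : set T) : Prop :=
  prime_ideal S P /\ forall Q, prime_ideal S Q -> Q `<=` P -> Q = P.

Definition lower_nilradical (T : pzRingType) (S : set T) : set T :=
  [set x | S x /\ forall P, prime_ideal S P -> P x].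

Definition lconductor (T : pzRingType) (R : set T) : set T :=
  [set x | forall t, R (t * x)].

Definition rconductor (T : pzRingType) (R : set T) : set T :=
  [set x | forall t, R (x * t)].

Definition lann (T : pzRingType) (X : set T) : set T :=
  [set t | forall x, X x -> t * x = 0].

Definition rann (T : pzRingType) (X : set T) : set T :=
  [set t | forall x, X x -> x * t = 0].

Definition fg_right_ideal (T : pzRingType) (S I : set T) : Prop :=
  is_right_ideal S I /\
  exists n (x : 'I_n -> T),
    I = [set y | exists r : 'I_n -> T,
           (forall i, S (r i)) /\ y = \sum_(i < n) x i * r i].

(* T embeds, as a right S-module, in the n-th power of N, where N is a subset
   of T which is a right S-submodule. *)
Definition embeds_in_power (T : pzRingType) (S N : set T) (n : nat) : Prop :=
  exists f : {additive T -> {ffun 'I_n -> T}},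
    [/\ injective f, forall t i, N (f t i) &
        forall t s i, S s -> f (t * s) i = f t i * s].

(* Main.v *)
(* A prime ideal of a left artinian ring is maximal, and both conductors are
   prime in R, hence maximal there.  An ideal M of T not contained in R satisfies
   R + M = T, so that T/M = R/(M `&` R); this gives (1) and (2), and it gives (5)
   because T(R:T)_r <= R would force (R:T)_l = (R:T)_r to be an ideal of T.
   For (3) and (4), J(T) `&` R <= J(R) always holds, and a maximal left ideal of T
   with core A (the annihilator of T/M) contains J(R) unless A <= R.  As
   I P = 0 is in the prime A, that exception forces I <= A <= P; and if (R:T)_l
   is generated by x_1, ..., x_n over R then t |-> (t x_i) embeds T/A into
   ((R:T)_l/A)^n, so T/A is left artinian and A is a maximal ideal of T contained
   in R, which (2) forbids. *)
From HB Require Import structures.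
Require Import Defs.
From mathcomp Require Import all_boot all_algebra.
From mathcomp Require Import boolp classical_sets functions cardinality.

Set Implicit Arguments.
Unset Strict Implicit.
Unset Printing Implicit Defensive.

Import GRing.Theory.
Local Open Scope classical_set_scope.
Local Open Scope card_scope.
Local Open Scope ring_scope.

(** * Subsets of an additive group closed under subtraction *)

Section ZmodSets.
Variable V : zmodType.
Implicit Types A B : set V.

Lemma zmod_setP A : GRing.zmod_closed [in A] <->
  A 0 /\ forall x y, A x -> A y -> A (x - y).
Proof.
split=> [[A0 AB]|[A0 AB]]; split; rewrite ?inE // in A0 *.
  by move=> x y Ax Ay; move: (AB x y); rewrite !inE; apply.
by move=> x y; rewrite !inE; exact: AB.
Qed.

Lemma zmod_set0 A : GRing.zmod_closed [in A] -> A 0.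
Proof. by case/zmod_setP. Qed.

Lemma zmod_setB A x y : GRing.zmod_closed [in A] -> A x -> A y -> A (x - y).
Proof. by case/zmod_setP=> _; apply. Qed.

Lemma zmod_setN A x : GRing.zmod_closed [in A] -> A x -> A (- x).
Proof. by move=> zA Ax; rewrite -sub0r; apply: zmod_setB => //; exact: zmod_set0. Qed.

Lemma zmod_setD A x y : GRing.zmod_closed [in A] -> A x -> A y -> A (x + y).
Proof. by move=> zA Ax Ay; rewrite -[y]opprK; apply: zmod_setB => //; apply: zmod_setN. Qed.

Lemma zmod_set_sum A n (F : 'I_n -> V) : GRing.zmod_closed [in A] ->
  (forall i, A (F i)) -> A (\sum_(i < n) F i).
Proof.
move=> zA AF; elim/big_ind: _ => //; first exact: zmod_set0.
by move=> x y; apply: zmod_setD.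
Qed.

Lemma zmod_setT : GRing.zmod_closed [in [set: V]].
Proof. by apply/zmod_setP. Qed.

Lemma zmod_setI A B : GRing.zmod_closed [in A] -> GRing.zmod_closed [in B] ->
  GRing.zmod_closed [in A `&` B].
Proof.
move=> zA zB; apply/zmod_setP; split; first by split; apply: zmod_set0.
by move=> x y [Ax Bx] [Ay By]; split; apply: zmod_setB.
Qed.

Lemma zmod_set_add A B : GRing.zmod_closed [in A] -> GRing.zmod_closed [in B] ->
  GRing.zmod_closed [in [set x + y | x in A & y in B]].
Proof.
move=> zA zB; apply/zmod_setP; split.
  by exists 0; [exact: zmod_set0|exists 0; [exact: zmod_set0|rewrite addr0]].
move=> _ _ [x Ax [y By <-]] [z Az [w Bw <-]].
exists (x - z); first exact: zmod_setB.
by exists (y - w); [exact: zmod_setB|rewrite opprD addrACA].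
Qed.

Lemma sub_addl A B : GRing.zmod_closed [in B] ->
  A `<=` [set x + y | x in A & y in B].
Proof.
by move=> zB x Ax; exists x => //; exists 0; rewrite ?addr0//; exact: zmod_set0.
Qed.

Lemma sub_addr A B : GRing.zmod_closed [in A] ->
  B `<=` [set x + y | x in A & y in B].
Proof.
by move=> zA x Bx; exists 0; [exact: zmod_set0|exists x; rewrite ?add0r].
Qed.

End ZmodSets.

(** * Ideals of a subring, their sums and products *)

Section Ideals.
Variable T : pzRingType.
Implicit Types S A B L M : set T.

Lemma subringP S : is_subring S <->
  [/\ S 1, GRing.zmod_closed [in S] & forall x y, S x -> S y -> S (x * y)].
Proof.
split=> [[S1 SB SM]|[S1 zS SM]]; rewrite ?inE in S1; split=> //.
- apply/zmod_setP; split=> [|x y Sx Sy]; last first.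
    by move: (SB x y); rewrite !inE; apply.
  by rewrite -(subrr 1); move: (SB 1 1); rewrite !inE; apply.
- by move=> x y Sx Sy; move: (SM x y); rewrite !inE; apply.
- by rewrite inE.
- by move=> x y; rewrite !inE; exact: zmod_setB.
- by move=> x y; rewrite !inE; exact: SM.
Qed.

Lemma subringT : is_subring [set: T].
Proof. by apply/subringP; split=> //; exact: zmod_setT. Qed.

Lemma left_ideal_zmod S L : is_left_ideal S L -> GRing.zmod_closed [in L].
Proof. by case. Qed.

Lemma left_ideal_sub S L : is_left_ideal S L -> L `<=` S.
Proof. by case. Qed.

Lemma ideal_zmod S A : is_ideal S A -> GRing.zmod_closed [in A].
Proof. by case=> /left_ideal_zmod. Qed.

Lemma ideal_left S A : is_ideal S A -> is_left_ideal S A.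
Proof. by case. Qed.

Lemma ideal_right S A : is_ideal S A -> is_right_ideal S A.
Proof. by case. Qed.

Lemma idealMl S A s x : is_ideal S A -> S s -> A x -> A (s * x).
Proof. by case=> -[_ _ Al] _; exact: Al. Qed.

Lemma idealMr S A s x : is_ideal S A -> S s -> A x -> A (x * s).
Proof. by case=> _ [_ _ Ar]; exact: Ar. Qed.

Lemma ideal_mk S A : A `<=` S -> GRing.zmod_closed [in A] ->
  (forall s x, S s -> A x -> A (s * x)) ->
  (forall s x, S s -> A x -> A (x * s)) -> is_ideal S A.
Proof. by []. Qed.

Lemma left_ideal1 S L : is_left_ideal S L -> L 1 -> L = S.
Proof.
move=> [LS _ SL] L1; apply/seteqP; split=> // s Ss.
by rewrite -[s]mulr1; exact: SL.
Qed.

Lemma left_idealI S A B : is_left_ideal S A -> is_left_ideal S B ->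
  is_left_ideal S (A `&` B).
Proof.
move=> [AS zA SA] [BS zB SB]; split; first by move=> x [/AS].
  exact: zmod_setI.
by move=> s x Ss [Ax Bx]; split; [exact: SA|exact: SB].
Qed.

Lemma left_ideal_add S A B : is_subring S -> is_left_ideal S A ->
  is_left_ideal S B -> is_left_ideal S [set x + y | x in A & y in B].
Proof.
move=> /subringP[_ zS _] [AS zA SA] [BS zB SB]; split.
- by move=> _ [x /AS Sx [y /BS Sy <-]]; exact: zmod_setD.
- exact: zmod_set_add.
- move=> s _ Ss [x Ax [y By <-]]; exists (s * x); first exact: SA.
  by exists (s * y); [exact: SB|rewrite mulrDr].
Qed.

Lemma ideal_add S A B : is_subring S -> is_ideal S A -> is_ideal S B ->
  is_ideal S [set x + y | x in A & y in B].
Proof.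
move=> rS idA idB; have [sub z ml] :=
  left_ideal_add rS (ideal_left idA) (ideal_left idB).
split=> //; split=> // s _ Ss [x Ax [y By <-]].
exists (x * s); first exact: idealMr idA _ _.
by exists (y * s); [exact: idealMr idB _ _|rewrite mulrDl].
Qed.

Lemma mulS_sub A B L : GRing.zmod_closed [in L] ->
  (forall a b, A a -> B b -> L (a * b)) -> mulS A B `<=` L.
Proof.
move=> zL AB _ [n [a [b [Aa Bb ->]]]].
by apply: zmod_set_sum => // i; exact: AB.
Qed.

Lemma mem_mulS A B a b : A a -> B b -> mulS A B (a * b).
Proof.
move=> Aa Bb; exists 1%N, (fun=> a), (fun=> b); split=> //.
by rewrite big_ord1.
Qed.

Lemma mulS_zmod A B : GRing.zmod_closed [in A] -> GRing.zmod_closed [in mulS A B].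
Proof.
move=> zA; apply/zmod_setP; split.
  by exists 0%N, (fun=> 0), (fun=> 0); split=> [[]//|[]//|]; rewrite big_ord0.
move=> _ _ [n [a [b [Aa Bb ->]]]] [m [c [d [Ac Bd ->]]]].
exists (n + m)%N,
  (fun i : 'I_(n + m) =>
     match fintype.split i with inl j => a j | inr j => - c j end),
  (fun i : 'I_(n + m) =>
     match fintype.split i with inl j => b j | inr j => d j end); split.
- by move=> i; case: fintype.split => j //; apply: zmod_setN.
- by move=> i; case: fintype.split.
- rewrite big_split_ord -sumrN /=; congr (_ + _); apply: eq_bigr => i _.
    by have -> : fintype.split (lshift m i) = inl i := unsplitK (inl i).
  by have -> : fintype.split (rshift n i) = inr i := unsplitK (inr i); rewrite mulNr.
Qed.

Lemma mulS_left_stable S A B : GRing.zmod_closed [in A] ->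
  (forall s x, S s -> A x -> A (s * x)) ->
  forall s x, S s -> mulS A B x -> mulS A B (s * x).
Proof.
move=> zA SA s x Ss; suff : mulS A B `<=` [set x | mulS A B (s * x)] by apply.
apply: mulS_sub => [|a b Aa Bb]; last first.
  by rewrite /= mulrA; apply: mem_mulS => //; exact: SA.
have zAB := mulS_zmod B zA.
apply/zmod_setP; split; first by rewrite /= mulr0; exact: zmod_set0.
by move=> y z /= Hy Hz; rewrite mulrBr; exact: zmod_setB.
Qed.

Lemma mulS_right_stable S A B : GRing.zmod_closed [in A] ->
  (forall s x, S s -> B x -> B (x * s)) ->
  forall s x, S s -> mulS A B x -> mulS A B (x * s).
Proof.
move=> zA BS s x Ss; suff : mulS A B `<=` [set x | mulS A B (x * s)] by apply.
apply: mulS_sub => [|a b Aa Bb]; last first.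
  by rewrite /= -mulrA; apply: mem_mulS => //; exact: BS.
have zAB := mulS_zmod B zA.
apply/zmod_setP; split; first by rewrite /= mul0r; exact: zmod_set0.
by move=> y z /= Hy Hz; rewrite mulrBl; exact: zmod_setB.
Qed.

Lemma mulS_ideal S A B : is_subring S -> is_left_ideal S A ->
  is_right_ideal S B -> is_ideal S (mulS A B).
Proof.
move=> /subringP[_ zS SM] [AS zA SA] [BS zB SB]; apply: ideal_mk.
- by apply: mulS_sub => // a b /AS Sa /BS Sb; exact: SM.
- exact: mulS_zmod.
- exact: mulS_left_stable.
- exact: mulS_right_stable.
Qed.

Lemma subring_ideal S : is_subring S -> is_ideal S S.
Proof.
move=> /subringP[S1 zS SM].
by apply: ideal_mk => // s x Ss Sx; exact: SM.
Qed.

Lemma prime_left_ideals S A L M : is_subring S -> prime_ideal S A ->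
  is_left_ideal S L -> is_left_ideal S M ->
  (forall x y, L x -> M y -> A (x * y)) -> L `<=` A \/ M `<=` A.
Proof.
move=> rS [[idA _] prA] idL idM LM.
have rightS := ideal_right (subring_ideal rS).
have [S1 _ SM] := (subringP S).1 rS.
have subS X : X `<=` mulS X S by move=> x Xx; rewrite -[x]mulr1; exact: mem_mulS.
have zA := ideal_zmod idA.
(* [L] S and [M] S are two-sided, and ([L] S)([M] S) lies in ([L] [M]) S, hence in [A], because S
   [M] lies in [M]. Primeness, stated for ideals, thus extends to left ideals. *)
case: (prA (mulS L S) (mulS M S)); [exact: mulS_ideal..| | |].
- apply: mulS_sub => // x y; move: x y.
  suff H m s l : M m -> S s -> mulS L S l -> A (l * (m * s)).
    move=> l y Hl; suff : mulS M S `<=` [set y | A (l * y)] by apply.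
    apply: mulS_sub => [|m s Mm Ss]; last exact: H.
    apply/zmod_setP; split=> [|y1 y2 /= H1 H2]; first by rewrite /= mulr0; exact: zmod_set0.
    by rewrite mulrBr; exact: zmod_setB.
  move=> Mm Ss; suff : mulS L S `<=` [set l | A (l * (m * s))] by apply.
  apply: mulS_sub => [|x r Lx Sr]; last first.
    rewrite /= -mulrA !mulrA -[_ * r * m]mulrA.
    by apply: (idealMr idA) => //; apply: LM => //; case: idM => _ _; apply.
  apply/zmod_setP; split=> [|y1 y2 /= H1 H2]; first by rewrite /= mul0r; exact: zmod_set0.
  by rewrite mulrBl; exact: zmod_setB.
- by move=> LA; left=> x /subS; exact: LA.
- by move=> MA; right=> x /subS; exact: MA.
Qed.

Lemma max_ideal_comax S M A : is_subring S -> Max S M -> is_ideal S A ->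
  ~ A `<=` M -> [set x + y | x in A & y in M] = S.
Proof.
move=> rS [[idM _] maxM] idA nA; apply: contrapT => neq; apply: nA.
rewrite -(maxM [set x + y | x in A & y in M]).
- exact: sub_addl (ideal_zmod idM).
- by split=> //; exact: ideal_add.
- exact: sub_addr (ideal_zmod idA).
Qed.

(** If neither factor lies in [M], then 1 = a + m = b + p, and multiplying the two expressions puts
    1 in AB + [M], hence in [M]. *)
Lemma max_prime S M : is_subring S -> Max S M -> prime_ideal S M.
Proof.
move=> rS mxM; have [[idM neq] _] := mxM; have [S1 zS _] := (subringP S).1 rS.
have zM := ideal_zmod idM.
split=> // A B idA idB AB; apply: contrapT => /not_orP[nA nB].
apply: neq; apply: left_ideal1; first exact: ideal_left.
have /seteqP[_ /(_ _ S1)[a Aa [m Mm am]]] := max_ideal_comax rS mxM idA nA.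
have /seteqP[_ /(_ _ S1)[b Bb [p Mp bp]]] := max_ideal_comax rS mxM idB nB.
rewrite -[1]mulr1 -{1}am -bp mulrDl; apply: zmod_setD => //; last first.
  by apply: (idealMr idM) => //; rewrite bp.
rewrite mulrDr; apply: zmod_setD => //; first exact/AB/mem_mulS.
by apply: (idealMl idM) => //; exact: left_ideal_sub (ideal_left idA) _ Aa.
Qed.

(** For an ideal [A] this says that S/A is left artinian, without forming the quotient ring. It is
    used both for [R] and for T itself. *)
Definition dcc_above S A := forall L : nat -> set T,
  (forall n, is_left_ideal S (L n)) -> (forall n, A `<=` L n) ->
  (forall n, L n.+1 `<=` L n) -> exists N, forall n, (N <= n)%N -> L N `<=` L n.

Lemma left_artinian_dcc_above S A : left_artinian S -> dcc_above S A.
Proof.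
move=> artS L idL _ /(artS _ idL)[N LN]; exists N => n /LN ->.
by [].
Qed.

(** Without a minimal member, choice gives a map to strictly smaller members, and its iterates form
    a chain that never stabilises. *)
Lemma dcc_above_min S A (Q : set (set T)) : dcc_above S A ->
  (exists L, [/\ is_left_ideal S L, A `<=` L & Q L]) ->
  exists L, [/\ is_left_ideal S L, A `<=` L, Q L &
    forall L', is_left_ideal S L' -> A `<=` L' -> Q L' -> L' `<=` L -> L' = L].
Proof.
move=> dccS [L0 GL0]; apply: contrapT => nomin.
pose G L := [/\ is_left_ideal S L, A `<=` L & Q L].
have /choice[f fP] L : exists L', G L -> [/\ G L', L' `<=` L & L' <> L].
  apply: contrapT => /forallNP H; have GL : G L.
    (* Choice needs a total function; [set0] is a dummy value where [G] fails. *)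
    by apply: contrapT => nG; apply: (H set0).
  apply: nomin; exists L; have [? ? ?] := GL; split=> // L' ? ? ? sub.
  by apply: contrapT => neq; apply: (H L').
have GL n : G (iter n f L0) by elim: n => //= n /fP[].
have [n||n|N /(_ N.+1 (leqnSn _)) LN] := dccS (fun n => iter n f L0).
- by case: (GL n).
- by move=> n; case: (GL n).
- by case: (fP _ (GL n)).
- have [_ sub] := fP _ (GL N); apply.
  by apply/seteqP; split.
Qed.

(* The artinian prime ring S/A is simple: among the left ideals comaximal with
   an ideal B > A, a minimal one L meets B in A, as otherwise a minimal left
   ideal K <= L `&` B with K k + A = K, k in K, splits off from L. *)
Lemma prime_dcc_max S A : is_subring S -> dcc_above S A -> prime_ideal S A ->
  Max S A.
Proof.
move=> rS dccA prA; have [S1 zS SM] := (subringP S).1 rS.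
have [[idA nA] _] := prA; split=> // B [idB nB] AB.
apply: contrapT => neqB.
have zA := ideal_zmod idA; have AS := left_ideal_sub (ideal_left idA).
have zB := ideal_zmod idB; have BS := left_ideal_sub (ideal_left idB).
have nBA : ~ B `<=` A by move=> BA; apply: neqB; apply/seteqP.
have [|L [idL AL LB minL]] := @dcc_above_min S A
    (fun L => forall s, S s -> exists2 b, B b & exists2 l, L l & s = b + l) dccA.
  exists S; split=> //; first exact: ideal_left (subring_ideal rS).
  by move=> s Ss; exists 0; [exact: zmod_set0|exists s; rewrite ?add0r].
have [zL LS] := (left_ideal_zmod idL, left_ideal_sub idL).
have LBA : L `&` B `<=` A.
  apply: contrapT => nLB.
  have [|K [idK AK [KLB nKA] minK]] := @dcc_above_min S A
      (fun K => K `<=` L `&` B /\ ~ K `<=` A) dccA.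
    exists (L `&` B); split=> //.
    - exact: left_idealI idL (ideal_left idB).
    - by move=> x Ax; split; [exact: AL|exact: AB].
    - by split.
  have [zK KS] := (left_ideal_zmod idK, left_ideal_sub idK).
  (* Otherwise [K] [K] lies in [A], and primeness puts [K] in [A]. *)
  have [k Kk nKk] : exists2 k, K k & ~ (forall x, K x -> A (x * k)).
    apply: contrapT => H; apply: nKA.
    suff HK x y : K x -> K y -> A (x * y).
      by case: (prime_left_ideals rS prA idK idK HK).
    move=> Kx Ky; apply: contrapT => nAxy; apply: H; exists y => // /(_ x Kx).
    exact: nAxy.
  pose Kk1 := [set y | exists2 x, K x & exists2 a, A a & y = x * k + a].
  have Kk1K : Kk1 = K.
    apply: minK.
    - split.
      + move=> _ [x /KS Sx [a /AS Sa ->]].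
        by apply: zmod_setD => //; apply: SM => //; exact: KS.
      + apply/zmod_setP; split.
          by exists 0; [exact: zmod_set0|exists 0; rewrite ?mul0r ?addr0//; exact: zmod_set0].
        move=> _ _ [x Kx [a Aa ->]] [y Ky [b Ab ->]].
        exists (x - y); first exact: zmod_setB.
        by exists (a - b); [exact: zmod_setB|rewrite opprD addrACA mulrBl].
      + move=> s _ Ss [x Kx [a Aa ->]]; exists (s * x).
          by case: idK => _ _; apply.
        by exists (s * a); [exact: idealMl idA _ _|rewrite mulrDr mulrA].
    - by move=> a Aa; exists 0; [exact: zmod_set0|exists a; rewrite ?mul0r ?add0r].
    - split=> [_ [x Kx [a Aa ->]]|Kk1A]; last first.
        apply: nKk => x Kx; apply: Kk1A; exists x => //.
        by exists 0; rewrite ?addr0//; exact: zmod_set0.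
      apply: KLB; apply: zmod_setD => //; last exact: AK.
      by case: idK => _ _; apply => //; exact: KS.
    - move=> _ [x Kx [a Aa ->]]; apply: zmod_setD => //; last exact: AK.
      by case: idK => _ _; apply => //; exact: KS.
  (* This set is a complement of [K] in [L] modulo [A]: for l in [L] one has l k = x k + a with x in
     [K], so l - x lies in the set while x lies in [B]. Hence it is still comaximal with [B], and
     minimality makes it all of [L]; as [K] lies in [L], this contradicts the choice of [k]. *)
  have L'L : L `&` [set x | A (x * k)] = L.
    apply: minL; last by move=> x [].
    - split; first by move=> x [/LS].
        apply: zmod_setI => //; apply/zmod_setP; split.
          by rewrite /= mul0r; exact: zmod_set0.
        by move=> x y /= Hx Hy; rewrite mulrBl; exact: zmod_setB.
      move=> s x Ss [Lx Ax]; split; first by case: idL => _ _; apply.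
      by rewrite /= -mulrA; exact: idealMl idA _ _.
    - by move=> a Aa; split; [exact: AL|apply: (idealMr idA) => //; exact: KS].
    - move=> s /LB[b Bb [l Ll ->]].
      have : K (l * k) by case: idK => _ _; apply => //; exact: LS.
      rewrite -{1}Kk1K => -[x Kx [a Aa lk]].
      have [Lx Bx] := KLB _ Kx.
      exists (b + x); first exact: zmod_setD.
      exists (l - x); last by rewrite addrACA subrr addr0.
      split; first exact: zmod_setB.
      by rewrite /= mulrBl lk addrC addKr.
  by apply: nKk => x /KLB[]; rewrite -{1}L'L => -[].
(* [B] [L] lies in the intersection, hence in [A]. As [B] is not inside [A], primeness puts [L] in
   [A], so 1, an element of [B] + [L], lies in [B]. *)
have BLA b l : B b -> L l -> A (b * l).
  move=> Bb Ll; apply: LBA; split; first by case: idL => _ _; apply => //; exact: BS.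
  by apply: (idealMr idB) => //; exact: LS.
have [//|LA] := prime_left_ideals rS prA (ideal_left idB) idL BLA.
apply: nB; apply: left_ideal1; first exact: ideal_left.
have [b Bb [l /LA /AB Bl ->]] := LB 1 S1.
exact: zmod_setD.
Qed.

(** * Annihilators of simple modules, and existence of maximal left ideals *)

Definition core L : set T := [set t | forall s, L (t * s)].

Lemma core_sub L : core L `<=` L.
Proof. by move=> t /(_ 1); rewrite mulr1. Qed.

Lemma core_ideal L : is_left_ideal setT L -> is_ideal setT (core L).
Proof.
move=> [_ zL TL]; apply: ideal_mk => //.
- apply/zmod_setP; split=> [s|x y Hx Hy s]; first by rewrite mul0r; exact: zmod_set0.
  by rewrite mulrBl; exact: zmod_setB.
- by move=> t x _ Hx s; rewrite -mulrA; exact: TL.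
- by move=> t x _ Hx s; rewrite -mulrA.
Qed.

Lemma maximal_left_ideal_comax S M L : is_subring S -> maximal_left_ideal S M ->
  is_left_ideal S L -> ~ L `<=` M -> [set x + y | x in L & y in M] = S.
Proof.
move=> rS [idM _ maxM] idL nL; apply: contrapT => neq; apply: nL.
rewrite -(maxM _ (left_ideal_add rS idL idM) neq).
- exact: sub_addl (left_ideal_zmod idM).
- exact: sub_addr (left_ideal_zmod idL).
Qed.

(** The annihilator of the simple module T/M is prime: if [Y] does not kill T/M, then 1 = y + m with
    y in [Y], and x s = (x s) y + (x s) m lies in [M] for every x in [X]. *)
Lemma core_prime M : maximal_left_ideal setT M -> prime_ideal setT (core M).
Proof.
move=> mxM; have [idM neq _] := mxM; have idA := core_ideal idM.
have [_ zM TM] := idM.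
split=> [|X Y idX idY XY].
  split=> // coreT; apply: neq; apply/seteqP; split=> // x _.
  by apply: core_sub; rewrite coreT.
have [YA|nYA] := pselect (Y `<=` core M); [by right|left].
have nYM : ~ Y `<=` M.
  by move=> YM; apply: nYA => y Yy s; apply: YM; exact: (idealMr idY).
have /seteqP[_ /(_ 1 I)[y Yy [m Mm ym]]] :=
  maximal_left_ideal_comax subringT mxM (ideal_left idY) nYM.
move=> x Xx s; rewrite -[x * s]mulr1 -ym mulrDr; apply: zmod_setD => //.
  by apply: core_sub; apply: XY; apply: mem_mulS => //; exact: (idealMr idX).
exact: TM.
Qed.

Lemma exists_maximal_left_ideal L : is_left_ideal setT L -> ~ L 1 ->
  exists2 M, maximal_left_ideal setT M & L `<=` M.
Proof.
move=> idL nL1; have [_ zL TL] := idL.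
(* Joining [L] to [A] lets the empty chain, whose union is [set0], satisfy [P] as well. *)
pose P A := is_left_ideal setT (A `|` L) /\ ~ (A `|` L) 1.
have [F FP totF|A [[idA nA1] maxA]] := @Zorn_bigcup T P; last first.
  exists (A `|` L); last by move=> x; right.
  split=> // [AT|M idM nM AM]; first by apply: nA1; rewrite AT.
  apply/seteqP; split=> //; have [MA|nMA] := pselect (M `<=` A).
    by move=> x /MA; left.
  have ML : M `|` L = M.
    by apply/seteqP; split=> x; [case=> // Lx; apply: AM; right|left].
  case: (maxA M); first by split=> // x Ax; apply: AM; left.
  by rewrite /P ML; split=> // M1; apply: nM; exact: left_ideal1.
pose U := \bigcup_(X in F) X.
have UE x : (U `|` L) x -> L x \/ exists2 X, F X & (X `|` L) x.
  by case=> [[X FX Xx]|]; [right; exists X => //; left|left].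
have XU X x : F X -> (X `|` L) x -> (U `|` L) x.
  by move=> FX [Xx|]; [left; exists X|right].
have XzM X : F X -> GRing.zmod_closed [in X `|` L].
  by move=> /FP[/left_ideal_zmod].
split; last first.
  by move=> /UE[//|[X /FP[]]].
split=> //.
- apply/zmod_setP; split; first by right; exact: zmod_set0.
  move=> x y /UE[Lx|[X FX Xx]] /UE[Ly|[Y FY Yy]].
  + by right; exact: zmod_setB.
  + by apply: (XU Y) => //; apply: zmod_setB => //; [exact: XzM|right].
  + by apply: (XU X) => //; apply: zmod_setB => //; [exact: XzM|right].
  + have [XY|YX] := totF _ _ FX FY.
      apply: (XU Y) => //; apply: zmod_setB => //; first exact: XzM.
      by case: Xx => [/XY|]; [left|right].
    apply: (XU X) => //; apply: zmod_setB => //; first exact: XzM.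
    by case: Yy => [/YX|]; [left|right].
- move=> s x _ /UE[Lx|[X FX Xx]]; first by right; exact: TL.
  apply: (XU X) => //.
  by have [[_ _ TX] _] := FP _ FX; exact: TX.
Qed.

End Ideals.

(** * Maximal subrings: conductors and contraction of ideals *)

Section MaximalSubring.
Variables (T : pzRingType) (R : set T).
Hypothesis maxR : maximal_subring R.
Implicit Types A B M L : set T.

Let subR : is_subring R. Proof. by case: maxR. Qed.
Let R1 : R 1. Proof. by have /subringP[] := subR. Qed.
Let zR : GRing.zmod_closed [in R]. Proof. by have /subringP[] := subR. Qed.
Let RM x y : R x -> R y -> R (x * y).
Proof. by have /subringP[_ _] := subR; apply. Qed.

(** [R] + [B] is a subring strictly above [R]. Stability is asked under [R] only, so that [B] may be
    TA or BT for an ideal of [R], as well as an ideal of T. *)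
Lemma maximal_subring_add B : GRing.zmod_closed [in B] ->
  (forall r b, R r -> B b -> B (r * b)) ->
  (forall r b, R r -> B b -> B (b * r)) ->
  (forall a b, B a -> B b -> B (a * b)) -> ~ B `<=` R ->
  [set x + y | x in R & y in B] = setT.
Proof.
move=> zB RB BR BB nBR; have [_ _ maxS] := maxR.
have rS : is_subring [set x + y | x in R & y in B].
  apply/subringP; split; first exact: (sub_addl zB R1).
    exact: zmod_set_add.
  move=> _ _ [x Rx [b Bb <-]] [y Ry [c Bc <-]].
  exists (x * y); first exact: RM.
  exists (x * c + (b * y + b * c)); last by rewrite mulrDl !mulrDr addrA.
  by apply: zmod_setD => //; [exact: RB|apply: zmod_setD => //; [exact: BR|exact: BB]].
have [|SR|//] := maxS _ rS; first exact: sub_addl.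
by case: nBR; rewrite -SR; exact: sub_addr.
Qed.

Lemma maximal_subring_ideal_add M : is_ideal setT M -> ~ M `<=` R ->
  [set x + y | x in R & y in M] = setT.
Proof.
move=> idM; apply: maximal_subring_add; first exact: ideal_zmod idM.
- by move=> r b _; exact: (idealMl idM).
- by move=> r b _; exact: (idealMr idM).
- by move=> a b _; exact: (idealMl idM).
Qed.

Lemma lconductor_sub : lconductor R `<=` R.
Proof. by move=> x /(_ 1); rewrite mul1r. Qed.

Lemma rconductor_sub : rconductor R `<=` R.
Proof. by move=> x /(_ 1); rewrite mulr1. Qed.

Lemma lconductor_left_ideal : is_left_ideal setT (lconductor R).
Proof.
split=> //; last by move=> s x _ Cx t; rewrite mulrA; exact: Cx.
apply/zmod_setP; split=> [t|x y Cx Cy t]; first by rewrite mulr0; exact: zmod_set0.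
by rewrite mulrBr; exact: zmod_setB.
Qed.

Lemma rconductor_right_ideal : is_right_ideal setT (rconductor R).
Proof.
split=> //; last by move=> s x _ Dx t; rewrite -mulrA; exact: Dx.
apply/zmod_setP; split=> [t|x y Dx Dy t]; first by rewrite mul0r; exact: zmod_set0.
by rewrite mulrBl; exact: zmod_setB.
Qed.

Lemma lconductor_ideal : is_ideal R (lconductor R).
Proof.
have [_ zC TC] := lconductor_left_ideal.
apply: ideal_mk => //; first exact: lconductor_sub.
  by move=> s x _; exact: TC.
by move=> s x Rs Cx t; rewrite mulrA; exact: RM.
Qed.

Lemma rconductor_ideal : is_ideal R (rconductor R).
Proof.
have [_ zD DT] := rconductor_right_ideal.
apply: ideal_mk => //; first exact: rconductor_sub.
  by move=> s x Rs Dx t; rewrite -mulrA; exact: RM.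
by move=> s x _; exact: DT.
Qed.

Lemma sub_lconductor L : is_left_ideal setT L -> L `<=` R -> L `<=` lconductor R.
Proof. by move=> [_ _ TL] LR x Lx t; apply: LR; exact: TL. Qed.

Lemma sub_rconductor L : is_right_ideal setT L -> L `<=` R -> L `<=` rconductor R.
Proof. by move=> [_ _ TL] LR x Lx t; apply: LR; exact: TL. Qed.

(* If A is not contained in C = (R:T)_l then T = R + TA, so that
   TB <= RB + TAB <= B + TC <= R as soon as AB <= C. *)
Lemma lconductor_prime : prime_ideal R (lconductor R).
Proof.
have [_ neqR _] := maxR.
split=> [|A B idA idB AB].
  split=> [|CR]; first exact: lconductor_ideal.
  apply: neqR; apply/seteqP; split=> // t _.
  by rewrite -[t]mulr1; move: R1; rewrite -{1}CR; apply.
have zA := ideal_zmod idA.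
have [AC|nAC] := pselect (A `<=` lconductor R); [by left|right].
have TA1 : [set x + y | x in R & y in mulS setT A] = setT.
  apply: maximal_subring_add.
  - exact/mulS_zmod/zmod_setT.
  - by apply: mulS_left_stable => //; exact: zmod_setT.
  - by apply: mulS_right_stable => [|s x]; [exact: zmod_setT|exact: (idealMr idA)].
  - move=> a b _; apply: (@mulS_left_stable _ setT) => //; exact: zmod_setT.
  - move=> TAR; apply: nAC => x Ax t; apply: TAR; exact: mem_mulS.
move=> b Bb t; have /seteqP[_ /(_ t I)[r Rr [y + <-]]] := TA1.
suff : mulS setT A `<=` [set y | R (y * b)].
  move=> /[apply] Ryb; rewrite mulrDl; apply: zmod_setD => //.
  by apply: RM => //; exact: left_ideal_sub (ideal_left idB) _ Bb.
apply: mulS_sub => [|u a _ Aa]; last first.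
  by rewrite /= -mulrA; apply: AB; exact: mem_mulS.
apply/zmod_setP; split; first by rewrite /= mul0r; exact: zmod_set0.
by move=> y1 y2 /= H1 H2; rewrite mulrBl; exact: zmod_setB.
Qed.

(** Mirror image of the left case: if [B] is not inside the right conductor, then T = R + BT, and AT
    lies in AR + (AB)T, hence in [R]. *)
Lemma rconductor_prime : prime_ideal R (rconductor R).
Proof.
have [_ neqR _] := maxR.
split=> [|A B idA idB AB].
  split=> [|CR]; first exact: rconductor_ideal.
  apply: neqR; apply/seteqP; split=> // t _.
  by rewrite -[t]mul1r; move: R1; rewrite -{1}CR; apply.
have zB := ideal_zmod idB.
have [BD|nBD] := pselect (B `<=` rconductor R); [by right|left].
have BT1 : [set x + y | x in R & y in mulS B setT] = setT.
  apply: maximal_subring_add.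
  - exact: mulS_zmod.
  - by apply: mulS_left_stable => // s x; exact: (idealMl idB).
  - by apply: mulS_right_stable.
  - by move=> a b Ba _; apply: (@mulS_right_stable _ setT).
  - move=> BTR; apply: nBD => x Bx t; apply: BTR; exact: mem_mulS.
move=> a Aa t; have /seteqP[_ /(_ t I)[r Rr [y + <-]]] := BT1.
suff : mulS B setT `<=` [set y | R (a * y)].
  move=> /[apply] Ray; rewrite mulrDr; apply: zmod_setD => //.
  by apply: RM => //; exact: left_ideal_sub (ideal_left idA) _ Aa.
apply: mulS_sub => [|b u Bb _]; last first.
  by rewrite /= mulrA; apply: AB; exact: mem_mulS.
apply/zmod_setP; split; first by rewrite /= mulr0; exact: zmod_set0.
by move=> y1 y2 /= H1 H2; rewrite mulrBr; exact: zmod_setB.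
Qed.

Lemma contraction_ideal M : is_ideal setT M -> is_ideal R (M `&` R).
Proof.
move=> idM; have zM := ideal_zmod idM; apply: ideal_mk.
- by move=> x [].
- exact: zmod_setI.
- by move=> s x Rs [Mx Rx]; split; [exact: (idealMl idM)|exact: RM].
- by move=> s x Rs [Mx Rx]; split; [exact: (idealMr idM)|exact: RM].
Qed.

Lemma contraction_neq M : is_proper_ideal setT M -> M `&` R <> R.
Proof.
move=> [idM neq] MR; apply: neq; apply: left_ideal1; first exact: ideal_left.
by move: R1; rewrite -MR => -[].
Qed.

(** A proper ideal [N] above [M] contracts to a proper ideal of [R] containing [A], hence to [A].
    Since T = R + M, it follows that N = (N [&] R) + M = M. *)
Lemma max_of_contraction A M : Max R A -> A `<=` M -> is_proper_ideal setT M ->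
  ~ M `<=` R -> Max setT M.
Proof.
move=> [[idA _] maxA] AM pM nMR; split=> // N pN MN.
have [idM _] := pM; have [idN _] := pN; have zN := ideal_zmod idN.
apply/seteqP; split=> // x Nx.
have /seteqP[_ /(_ x I)[r Rr [m Mm rm]]] := maximal_subring_ideal_add idM nMR.
suff Ar : A r by rewrite -rm; apply: zmod_setD; [exact: ideal_zmod idM|exact: AM|].
rewrite -(maxA (N `&` R)).
- split=> //; rewrite -[r](addrK m) rm; apply: zmod_setB => //; exact: MN.
- by split; [exact: contraction_ideal|exact: contraction_neq].
- by move=> a Aa; split; [exact/MN/AM|exact: left_ideal_sub (ideal_left idA) _ Aa].
Qed.

(** For a proper ideal [A] of [R] above the contraction, A + M is an ideal of T because T = R + M.
    It is proper: 1 = a + m would put m = 1 - a in the contraction, hence in [A]. So A + M = M. *)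
Lemma max_contraction M : Max setT M -> ~ M `<=` R -> Max R (M `&` R).
Proof.
move=> [pM maxM] nMR; have [idM _] := pM; have zM := ideal_zmod idM.
split=> [|A [idA neqA] MRA].
  by split; [exact: contraction_ideal|exact: contraction_neq].
have zA := ideal_zmod idA; have AR := left_ideal_sub (ideal_left idA).
have RMT := maximal_subring_ideal_add idM nMR.
have split_ t : exists2 r, R r & exists2 m, M m & t = r + m.
  by have /seteqP[_ /(_ t I)[r Rr [m Mm rm]]] := RMT; exists r => //; exists m.
apply/seteqP; split=> // x Ax; split; last exact: AR.
rewrite -(maxM [set x + y | x in A & y in M]).
- exact: sub_addl Ax.
- split.
    apply: ideal_mk => //; first exact: zmod_set_add.
      move=> t _ _ [a Aa [m Mm <-]]; have [r Rr [n Mn ->]] := split_ t.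
      exists (r * a); first exact: (idealMl idA).
      exists (r * m + n * (a + m)); last by rewrite !mulrDl !mulrDr !addrA.
      by apply: zmod_setD => //; [exact: (idealMl idM)|exact: (idealMr idM)].
    move=> t _ _ [a Aa [m Mm <-]]; have [r Rr [n Mn ->]] := split_ t.
    exists (a * r); first exact: (idealMr idA).
    exists (a * n + m * (r + n)).
      by apply: zmod_setD => //; [exact: (idealMl idM)|exact: (idealMr idM)].
    by rewrite !mulrDl !mulrDr !addrA.
  move=> AMT; have : [set: T] 1 by [].
  rewrite -AMT => -[a Aa [m Mm am]]; apply: neqA.
  apply: left_ideal1; first exact: ideal_left.
  rewrite -am; apply: zmod_setD => //; apply: MRA; split=> //.
  by rewrite -[m](addKr a) am; apply: zmod_setD => //; apply: zmod_setN => //; exact: AR.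
- exact: sub_addr.
Qed.

(** Here T = R + [core M], and [core M] kills T/M, so T/M has the same submodules over [R] as over
    T. Thus the contraction of [M] is a maximal left ideal of [R]. *)
Lemma jacobson_sub_max_left_ideal M : maximal_left_ideal setT M ->
  ~ core M `<=` R -> jacobson R `<=` M.
Proof.
move=> [idM nM maxM] ncore x [_ Jx]; have [_ zM TM] := idM.
have RcT := maximal_subring_ideal_add (core_ideal idM) ncore.
suff /Jx[//] : maximal_left_ideal R (M `&` R).
have nM1 : ~ M 1 by move=> M1; apply: nM; exact: left_ideal1.
split=> [|MR|L idL nL ML].
- split; [by move=> y []|exact: zmod_setI|].
  by move=> r y Rr [My Ry]; split; [exact: TM|exact: RM].
- by move: R1; rewrite -MR => -[].
have [LR zL RL] := idL.
apply/seteqP; split=> // y Ly; split; last exact: LR.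
rewrite -(maxM [set y + z | y in L & z in M]).
- exact: sub_addl Ly.
- split=> //; first exact: zmod_set_add.
  move=> t _ _ [l Ll [m Mm <-]].
  have /seteqP[_ /(_ t I)[r Rr [a Aa <-]]] := RcT.
  exists (r * l); first exact: RL.
  exists (a * l + (r + a) * m); last by rewrite !mulrDl !mulrDr addrACA !addrA.
  by apply: zmod_setD => //; exact: TM.
- move=> LMT; have : [set: T] 1 by [].
  rewrite -LMT => -[l Ll [m Mm lm]]; apply: nL; apply: left_ideal1 => //.
  rewrite -lm; apply: zmod_setD => //; apply: ML; split=> //.
  by rewrite -[m](addKr l) lm addrC; apply: zmod_setB => //; exact: LR.
- exact: sub_addr.
Qed.

End MaximalSubring.

(** * Comparing the Jacobson radicals of T and of a left artinian subring *)

Lemma jacobson_left_inverse (T : pzRingType) (x : T) :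
  jacobson setT x -> exists u, u * (1 - x) = 1.
Proof.
move=> [_ Jx]; apply: contrapT => ninv.
have idL : is_left_ideal setT [set y | exists u, y = u * (1 - x)].
  split=> //; last by move=> s _ _ [u ->]; exists (s * u); rewrite mulrA.
  apply/zmod_setP; split; first by exists 0; rewrite mul0r.
  by move=> _ _ [u ->] [v ->]; exists (u - v); rewrite mulrBl.
(* Otherwise T(1 - x) lies in a maximal left ideal; this also contains x, hence 1. *)
have [|M mxM LM] := exists_maximal_left_ideal idL.
  by move=> [u u1]; apply: ninv; exists u.
have [idM neq _] := mxM; apply: neq; apply: left_ideal1 => //.
rewrite -(subrK x 1); apply: zmod_setD; [exact: left_ideal_zmod idM| |exact: Jx].
by apply: LM; exists 1; rewrite mul1r.
Qed.

Lemma jacobsonMl (T : pzRingType) (u x : T) :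
  jacobson setT x -> jacobson setT (u * x).
Proof.
move=> [_ Jx]; split=> // M mxM.
by have [[_ _ TM] _ _] := mxM; apply: TM => //; exact: Jx.
Qed.

(* For x in J(T) `&` R outside a maximal left ideal M of R, some m = 1 - r x in M
   is invertible in T; then m^N = s m^(N+1) with s in R forces s m = 1. *)
Lemma artinian_jacobson_sub (T : pzRingType) (R : set T) : is_subring R ->
  left_artinian R -> jacobson setT `&` R `<=` jacobson R.
Proof.
move=> rR artR x [Jx Rx]; split=> // M mxM; apply: contrapT => nMx.
have [R1 zR RM] := (subringP R).1 rR.
have [[MR zM RsM] nM _] := mxM.
have idL : is_left_ideal R [set y | exists2 r, R r & y = r * x].
  split; first by move=> _ [r Rr ->]; exact: RM.
    apply/zmod_setP; split; first by exists 0; rewrite ?mul0r//; exact: zmod_set0.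
    by move=> _ _ [u Ru ->] [v Rv ->]; exists (u - v); [exact: zmod_setB|rewrite mulrBl].
  by move=> s _ Rs [r Rr ->]; exists (s * r); [exact: RM|rewrite mulrA].
have nLM : ~ [set y | exists2 r, R r & y = r * x] `<=` M.
  by move=> LM; apply: nMx; apply: LM; exists 1; rewrite ?mul1r.
have /seteqP[_ /(_ 1 R1)[_ [r Rr ->] [m Mm rxm]]] :=
  maximal_left_ideal_comax rR mxM idL nLM.
have mE : m = 1 - r * x by rewrite -rxm addrC addKr.
have [u] := jacobson_left_inverse (jacobsonMl r Jx).
rewrite -mE => um.
have uE : 1 + u * (r * x) = u by rewrite -{1}um mE mulrBr mulr1 subrK.
(* Since u = 1 + u r x is again 1 minus an element of J(T), it has a left inverse [w]; together with
   u m = 1 this gives w = m, so [m] is invertible on both sides. *)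
have [w] := jacobson_left_inverse (jacobsonMl (- u) (jacobsonMl r Jx)).
rewrite mulNr opprK uE => wu.
have mu : m * u = 1.
  have -> : m = w by rewrite -[m]mul1r -wu -mulrA um mulr1.
  exact: wu.
have [|n|N /(_ N.+1 (leqnSn N))/seteqP[_ LN]] :=
    artR (fun n => [set y | exists2 s, R s & y = s * m ^+ n]).
- move=> n; split.
  + by move=> _ [s Rs ->]; apply: (RM) => //; elim: n => // n IHn;
      rewrite exprS; apply: RM => //; exact: MR.
  + apply/zmod_setP; split; first by exists 0; rewrite ?mul0r//; exact: zmod_set0.
    by move=> _ _ [a Ra ->] [b Rb ->]; exists (a - b); [exact: zmod_setB|rewrite mulrBl].
  + by move=> s _ Rs [a Ra ->]; exists (s * a); [exact: RM|rewrite mulrA].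
- move=> _ [s Rs ->]; exists (s * m); first by apply: RM => //; exact: MR.
  by rewrite exprS mulrA.
have [|s Rs] := LN (m ^+ N); first by exists 1; rewrite ?mul1r.
rewrite exprS mulrA => mN.
have muN n : m ^+ n * u ^+ n = 1.
  elim: n => [|n IHn]; first by rewrite mulr1.
  by rewrite exprSr exprS mulrA -[_ * m * u]mulrA mu mulr1.
apply: nM; apply: left_ideal1; first by case: mxM.
by rewrite -(muN N) mN -mulrA muN mulr1; exact: RsM.
Qed.

(** * Left artinian maximal subrings *)

Section ArtinianMaximalSubring.
Variables (T : pzRingType) (R : set T).
Hypotheses (maxR : maximal_subring R) (artR : left_artinian R).

Let subR : is_subring R. Proof. by case: maxR. Qed.

Lemma lconductor_max : Max R (lconductor R).
Proof.
by apply: prime_dcc_max (lconductor_prime maxR); [|exact: left_artinian_dcc_above].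
Qed.

Lemma rconductor_max : Max R (rconductor R).
Proof.
by apply: prime_dcc_max (rconductor_prime maxR); [|exact: left_artinian_dcc_above].
Qed.

(* Within a descending chain, L n is determined by the left R-module L n x + A
   and the kernel {t in L n | t x in A} of t |-> t x modulo A. *)
Lemma chain_stable_seq (A : set T) (s : seq T) (L : nat -> set T) :
  is_ideal setT A -> A `<=` R -> (forall x, x \in s -> lconductor R x) ->
  (forall n, is_left_ideal setT (L n)) -> (forall n, L n.+1 `<=` L n) ->
  (exists N, forall n, (N <= n)%N ->
     forall t, L N t -> (forall x, x \in s -> A (t * x)) -> L n t) ->
  exists N, forall n, (N <= n)%N -> L N `<=` L n.
Proof.
move=> idA AR; have zA := ideal_zmod idA.
have [_ zR RM] := (subringP R).1 subR.
elim: s L => [|x s IHs] L sC idL decL [N LN].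
  by exists N => n /LN H t Lt; exact: H.
have Cx : lconductor R x by apply: sC; rewrite mem_head.
have mono n m : (n <= m)%N -> L m `<=` L n.
  move=> /subnK <-; elim: (m - n)%N => // k IHk t; rewrite addSn => /decL.
  exact: IHk.
(* The induction hypothesis handles the kernels of multiplication by [x] modulo [A]. *)
have [||||N1 LN1] := IHs (fun n => L n `&` [set t | A (t * x)]).
- by move=> y ys; apply: sC; rewrite inE ys orbT.
- move=> n; apply: left_idealI => //; split=> //.
    apply/zmod_setP; split; first by rewrite /= mul0r; exact: zmod_set0.
    by move=> y z /= Hy Hz; rewrite mulrBl; exact: zmod_setB.
  by move=> u y _ /=; rewrite -mulrA; exact: (idealMl idA).
- by move=> n t [/decL].
- exists N => n Nn t [Lt Atx] ts; split=> //; apply: (LN n) => // y.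
  by rewrite inE => /orP[/eqP->//|]; exact: ts.
(* The images L n x + A lie in [R], because [x] is in the left conductor, so they stabilise by the
   artinian hypothesis. *)
have [|n|N2 LN2] := @artR (fun n => [set y | exists2 t, L n t &
    exists2 a, A a & y = t * x + a]).
- move=> n; have zL := left_ideal_zmod (idL n); split.
  + by move=> _ [t Lt [a Aa ->]]; apply: zmod_setD => //; exact: AR.
  + apply/zmod_setP; split.
      by exists 0; [exact: zmod_set0|exists 0; rewrite ?mul0r ?addr0//; exact: zmod_set0].
    move=> _ _ [t Lt [a Aa ->]] [u Lu [b Ab ->]].
    exists (t - u); first exact: zmod_setB.
    by exists (a - b); [exact: zmod_setB|rewrite opprD addrACA mulrBl].
  + move=> r _ Rr [t Lt [a Aa ->]]; exists (r * t).
      by case: (idL n) => _ _; apply.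
    by exists (r * a); [exact: (idealMl idA)|rewrite mulrDr mulrA].
- by move=> y [t /decL Lt Aa]; exists t.
exists (maxn N1 N2) => n; rewrite geq_max => /andP[N1n N2n] t Lt.
have /seteqP[_ H] := LN2 _ N2n.
(* Equal images give t x = u x + a with u in [L n]; then t - u is in the kernel at stage [N1], which
   is inside [L n]. *)
have [|u Lu [a Aa tx]] := H (t * x).
  exists t; first exact: mono (leq_maxr _ _) _ Lt.
  by exists 0; rewrite ?addr0//; exact: zmod_set0.
have zLn := left_ideal_zmod (idL n).
rewrite -(subrK u t); apply: zmod_setD => //.
suff [] : (L n `&` [set t | A (t * x)]) (t - u) by [].
apply: (LN1 _ N1n); split.
  apply: zmod_setB; [exact: left_ideal_zmod (idL _)|exact: mono (leq_maxl _ _) _ Lt|].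
  exact: mono N1n _ Lu.
by rewrite /= mulrBl tx addrC addKr.
Qed.

(** If t x_i is in [A] for all generators x_i of C = (R:T)_l, then tC lies in [A], and primeness
    gives t in [A] since C does not lie in [A]. So multiplication by the x_i detects membership in
    [A], which yields the chain condition for left ideals of T above [A]. *)
Lemma prime_sub_lconductor_max (A : set T) : prime_ideal setT A ->
  A `<=` R -> ~ lconductor R `<=` A -> fg_right_ideal R (lconductor R) ->
  Max setT A.
Proof.
move=> prA AR nCA [_ [n [x CE]]]; have [[idA _] _] := prA.
have zA := ideal_zmod idA; have [R1 zR _] := (subringP R).1 subR.
have Cx i : lconductor R (x i).
  rewrite CE; exists (fun j => (j == i)%:R); split.
    by move=> j; case: eqP => // _; exact: zmod_set0.
  rewrite (bigD1 i)//= eqxx mulr1 big1 ?addr0// => j /negPf ->.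
  by rewrite mulr0.
have key t : (forall i, A (t * x i)) -> A t.
  move=> tA; have idK : is_left_ideal setT [set t | forall c, lconductor R c -> A (t * c)].
    split=> //.
      apply/zmod_setP; split; first by move=> c _; rewrite mul0r; exact: zmod_set0.
      by move=> y z Hy Hz c Cc; rewrite mulrBl; apply: zmod_setB => //; [exact: Hy|exact: Hz].
    by move=> s y _ Hy c Cc; rewrite -mulrA; apply: (idealMl idA) => //; exact: Hy.
  have [|KA|//] := prime_left_ideals (subringT T) prA idK (lconductor_left_ideal maxR).
  - by move=> y c; apply.
  - apply: KA => c; rewrite CE => -[r [Rr ->]]; rewrite mulr_sumr.
    by apply: zmod_set_sum => // i; rewrite mulrA; exact: (idealMr idA).
apply: prime_dcc_max => //; first exact: subringT.
move=> L idL AL decL.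
apply: (@chain_stable_seq A [seq x i | i <- enum 'I_n]) => //.
  by move=> _ /mapP[i _ ->].
(* Stage 0 suffices: the common kernel is inside [A], and [A] is inside every member of the
   chain. *)
exists 0%N => m _ t _ tA; apply: AL; apply: key => i; apply: tA.
by apply: map_f; rewrite mem_enum.
Qed.

End ArtinianMaximalSubring.

(** Writing 1 as the sum of the a_i b_i with b_i in [D], the map sending t to (b_i t) is injective,
    since t is the sum of the a_i (b_i t). The same map serves over T and over [R]. *)
Lemma embeds_in_power_of_mulST (T : pzRingType) (R D : set T) : D `<=` R ->
  is_right_ideal setT D -> mulS setT D 1 ->
  exists n, embeds_in_power setT D n /\ embeds_in_power R R n.
Proof.
move=> DR [_ _ DT] [n [a [b [_ Db ab]]]].
pose f (t : T) : {ffun 'I_n -> T} := [ffun i => b i * t].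
have fB : zmod_morphism f by move=> x y; apply/ffunP => i; rewrite !ffunE mulrBr.
pose fA := GRing.isZmodMorphism.Build _ _ f fB.
pose F : {additive T -> {ffun 'I_n -> T}} := HB.pack f fA.
have finj : injective F.
  move=> x y /ffunP fxy; rewrite -[x]mul1r -[y]mul1r ab !mulr_suml.
  apply: eq_bigr => i _; have := fxy i; rewrite !ffunE -!mulrA => ->.
  by [].
have FD t i : D (F t i) by rewrite ffunE; exact: DT.
have FM t s i : F (t * s) i = F t i * s by rewrite !ffunE mulrA.
by exists n; split; exists F; split=> // t i; exact: DR.
Qed.

(** * Maximal ideals, radicals and conductors over a left artinian maximal subring *)

Theorem theorem4p6 (T : pzRingType) (R : set T)
  (maxR : maximal_subring R)
  (artR : left_artinian R)
  (lc_not_ideal : ~ is_ideal setT (lconductor R))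
  (lcT_proper : is_proper_ideal setT (mulS (lconductor R) setT)) :
  let C := lconductor R in
  let D := rconductor R in
  let P := mulS C setT in
  let I := lann C in
  [/\ (* (1) *)
      Max setT P,
      (* (2) *)
      [/\ forall M, Max setT M -> ~ (M `<=` R),
          forall M, Max setT M -> Max R (M `&` R),
          forall M N, Max setT M -> Max setT N -> M <> N ->
            M `&` R <> N `&` R &
          @Max T setT #<= Max R],
      (* (3) *)
      (minimal_prime_ideal setT P /\
         jacobson R = jacobson setT `&` R) \/
      [/\ mulS I I = [set 0], I `<=` lower_nilradical setT &
          I <> [set 0] -> P = rann I],
      (* (4) *)
      jacobson R = jacobson setT `&` R \/ ~ fg_right_ideal R C &
      (* (5) *)
      Max setT (mulS setT D) \/
      exists n : nat,
        embeds_in_power setT D n /\ embeds_in_power R R n].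
Proof.
move=> C D P I; have [subR neqR maxS] := maxR.
have maxC : Max R C := lconductor_max maxR artR.
have maxD : Max R D := rconductor_max maxR artR.
have [idP neqP] := lcT_proper; have zP : GRing.zmod_closed [in P] := ideal_zmod idP.
have idlC : is_left_ideal setT C := lconductor_left_ideal maxR.
have zC := left_ideal_zmod idlC.
have idrD : is_right_ideal setT D := rconductor_right_ideal maxR.
have [_ zD DT] := idrD.
have CP : C `<=` P by move=> x Cx; rewrite -[x]mulr1; exact: mem_mulS.
have sub_C M : is_ideal setT M -> M `<=` R -> M `<=` C.
  by move=> /ideal_left; exact: sub_lconductor.
have nPR : ~ P `<=` R.
  move=> /(sub_C _ idP) PC; apply: lc_not_ideal.
  suff <- : P = lconductor R by [].
  by apply/seteqP; split.
have maxP : Max setT P by exact: max_of_contraction maxC CP lcT_proper nPR.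
have prP := max_prime (subringT T) maxP.
(* Such an [M] inside [R] would lie in [C], hence in [P], and so equal [P]. *)
have nMR M : Max setT M -> ~ M `<=` R.
  move=> [pM maxM] MR; have [idM _] := pM; apply: nPR.
  by rewrite (maxM P lcT_proper)// => x /(sub_C _ idM MR); exact: CP.
have contr M : Max setT M -> Max R (M `&` R).
  by move=> mxM; apply: max_contraction => //; exact: nMR.
have PRC : P `&` R = C.
  have [_ maxC'] := maxC; apply: maxC'; first by case: (contr _ maxP).
  by move=> x Cx; split; [exact: CP|exact: lconductor_sub Cx].
have max_eq (M N : set T) : Max setT M -> Max setT N -> M `<=` N -> M = N.
  by move=> [_ maxM] [pN _] MN; rewrite (maxM N).
have inj M N : Max setT M -> Max setT N -> M `&` R = N `&` R -> M = N.
  move=> mxM mxN MNR.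
  have [[idM _] _] := mxM; have [[idN _] _] := mxN.
  have zM := ideal_zmod idM.
  have idMN : is_ideal setT (M `&` N).
    split; first exact: left_idealI (ideal_left idM) (ideal_left idN).
    split=> //; first exact: zmod_setI (ideal_zmod idN).
    by move=> s x _ [Mx Nx]; split; [exact: (idealMr idM)|exact: (idealMr idN)].
  (* If the intersection is not inside [R], then T = R + (M [&] N), and M = (M [&] R) + (M [&] N)
     lies in [N]. *)
  have [MNsub|nMN] := pselect (M `&` N `<=` R); last first.
    apply: max_eq => // x Mx.
    have /seteqP[_ /(_ x Logic.I)[r Rr [y [My Ny] ryx]]] :=
      maximal_subring_ideal_add maxR idMN nMN.
    have [Nr _] : (N `&` R) r.
      by rewrite -MNR; split=> //; rewrite -[r](addrK y) ryx; exact: zmod_setB.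
    by rewrite -ryx; apply: zmod_setD => //; exact: ideal_zmod idN.
  (* Otherwise MN lies in the prime [P], so [M] or [N] is [P] and the common contraction is [C].
     Then [C] is the intersection of [M] and [N], an ideal of T. *)
  have MNC : M `&` N `<=` C by exact: sub_C.
  case: lc_not_ideal; suff <- : M `&` N = lconductor R by [].
  have MRC : M `&` R = C.
    have [_ /(_ M N idM idN)[|MP|NP]] := prP.
    - apply: mulS_sub => // a b Ma Nb; apply: CP; apply: MNC.
      by split; [exact: (idealMr idM)|exact: (idealMl idN)].
    - by rewrite (max_eq M P).
    - by rewrite MNR (max_eq N P).
  apply/seteqP; split=> // x; rewrite -/C => Cx; split.
    by move: Cx; rewrite -MRC => -[].
  by move: Cx; rewrite -MRC MNR => -[].
have jacE : (forall M, maximal_left_ideal setT M -> jacobson R `<=` M) ->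
    jacobson R = jacobson setT `&` R.
  move=> JM; apply/seteqP; split; last exact: artinian_jacobson_sub.
  by move=> x Jx; split; [split=> // M /JM; exact|case: Jx].
have nCA A : is_ideal setT A -> A `<=` R -> ~ C `<=` A.
  move=> idA AR CA; apply: nPR => x Px; apply: AR.
  move: x Px; apply: mulS_sub; first exact: ideal_zmod idA.
  by move=> c t /CA Ac _; exact: (idealMr idA).
have idI : is_ideal setT I.
  apply: ideal_mk => //.
  - apply/zmod_setP; split=> [c _|x y Ix Iy c Cc]; first by rewrite mul0r.
    by rewrite mulrBl Ix// Iy// subrr.
  - by move=> t x _ Ix c Cc; rewrite -mulrA Ix// mulr0.
  - move=> t x _ Ix c Cc; rewrite -mulrA; apply: Ix.
    by case: idlC => _ _; apply.
have IP0 x p : I x -> P p -> x * p = 0.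
  move=> Ix; move: p; apply: mulS_sub => [|c t Cc _]; last by rewrite mulrA Ix ?mul0r.
  apply/zmod_setP; split=> [|p q /= xp xq]; first by rewrite /= mulr0.
  by rewrite mulrBr xp xq subrr.
(* From [I] [P] = 0, the dichotomy that drives (3). *)
have prime_IP Q : prime_ideal setT Q -> I `<=` Q \/ P `<=` Q.
  move=> [[idQ _] prQ]; apply: prQ => //; have zQ := ideal_zmod idQ.
  by apply: mulS_sub => // x p Ix Pp; rewrite IP0//; exact: zmod_set0.
split=> //.
- split=> // [M N mxM mxN neq MN|].
    by apply: neq; exact: inj.
  have /injfunPex[f] : exists2 f : set T -> set T,
      set_fun (@Max T setT) (Max R) f & set_inj (@Max T setT) f.
    exists (fun M => M `&` R); first exact: contr.
    by move=> M N; rewrite !inE; exact: inj.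
  exact: inj_card_le f.
(* If [I] lies in [P], then its square lies in [I] [P] = 0 and every prime contains [I]. If not, a
   prime inside [P] cannot contain [I], so it contains [P]. *)
- have [IP|nIP] := pselect (I `<=` P); [right|left].
    split.
    + apply/seteqP; split=> [|_ ->].
        apply: mulS_sub => [|x y Ix /IP Py]; last exact: IP0.
        by apply/zmod_setP; split=> // x y -> ->; rewrite subrr.
      exact: zmod_set0 (mulS_zmod _ (ideal_zmod idI)).
    + move=> x Ix; split=> // Q prQ.
      by case: (prime_IP Q prQ) => [|PQ]; [exact|exact/PQ/IP].
    (* [rann I] is an ideal containing [P], and it is proper because 1 in it would make [I] zero;
       maximality of [P] concludes. *)
    + move=> nI0; apply/esym; have [_ maxP'] := maxP; apply: maxP'.
        split=> [|r1].
          apply: ideal_mk => //.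
          * apply/zmod_setP; split=> [x _|x y Hx Hy u Iu]; first by rewrite mulr0.
            by rewrite mulrBr Hx// Hy// subrr.
          * by move=> t x _ Hx u Iu; rewrite mulrA Hx//; exact: (idealMr idI).
          * by move=> t x _ Hx u Iu; rewrite mulrA Hx ?mul0r.
        apply: nI0; apply/seteqP; split=> [x Ix|_ ->]; last exact: zmod_set0 (ideal_zmod idI).
        have : rann I 1 by rewrite r1.
        by move=> /(_ x Ix); rewrite mulr1.
      by move=> p Pp x Ix; exact: IP0.
  split.
    split=> // Q prQ QP; apply/seteqP; split=> //.
    by case: (prime_IP Q prQ) => // IQ; case: nIP => x /IQ /QP.
  (* The core is prime, so if it were inside [R] it would contain [I], putting [I] in [C] and so in
     [P], or contain [P] and so [C]; both are excluded. *)
  apply: jacE => M mxM; apply: jacobson_sub_max_left_ideal => // AR.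
  have idA := core_ideal (let: And3 h _ _ := mxM in h).
  have [IA|PA] := prime_IP _ (core_prime mxM).
    by apply: nIP => x /IA /(sub_C _ idA AR) /CP.
  by apply: (nCA _ idA AR) => x /CP /PA.
- have [fgC|] := pselect (fg_right_ideal R C); [left|by right].
  apply: jacE => M mxM; apply: jacobson_sub_max_left_ideal => // AR.
  have idA := core_ideal (let: And3 h _ _ := mxM in h).
  have maxA := prime_sub_lconductor_max maxR artR (core_prime mxM) AR (nCA _ idA AR) fgC.
  exact: nMR maxA AR.
- have idTD : is_ideal setT (mulS setT D).
    apply: mulS_ideal => //; first exact: subringT.
    exact/ideal_left/subring_ideal/subringT.
  have DTD : D `<=` mulS setT D by move=> x Dx; rewrite -[x]mul1r; exact: mem_mulS.
  have [TD1|nTD1] := pselect (mulS setT D 1); [right|left].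
    by apply: embeds_in_power_of_mulST TD1 => //; exact: rconductor_sub.
  apply: (max_of_contraction maxR maxD DTD).
    by split=> // TDT; apply: nTD1; rewrite TDT.
  (* If TD is inside [R], it lies in both conductors. So [D] is inside [C], the two are equal by
     maximality of [D] in [R], and [C] = [D] = TD is an ideal of T. *)
  move=> TDR; apply: lc_not_ideal.
  have DC : D `<=` C by move=> x /DTD; exact: sub_C.
  have TDD : mulS setT D `<=` D by exact: sub_rconductor (ideal_right idTD) TDR.
  have CD : C = D.
    have [_ maxD'] := maxD; apply: maxD' => //; first by case: maxC.
  suff -> : lconductor R = mulS setT D by [].
  by rewrite -/C CD; apply/seteqP; split.
Qed.
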